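(* Let $0\leq j\leq 8$ be an integer and let $S_j=\{a\in\mathbb{Z}: a\equiv j+3\pmod 9\text{ or }a\equiv j-3\pmod 9\}$. Then every subset $T\subseteq\mathbb{Z}$ such that $T\cap S_j$ is finite has an odd covering.
   Context: A subset $A\subseteq\mathbb{Z}$ has an odd covering if there is a finite set of congruences $r_i\pmod{m_i}$, whose moduli $m_i$ are distinct odd integers greater than $1$, such that every element of $A$ satisfies at least one of these congruences. *)

(* Defs.v *)
From mathcomp Require Import all_boot all_order all_algebra.
From mathcomp Require Import classical_sets cardinality.

Set Implicit Arguments.
Unset Strict Implicit.
Unset Printing Implicit Defensive.

Local Open Scope classical_set_scope.

(* The pair (r, m) encodes the congruence r (mod m). *)
Definition has_odd_covering (A : set int) : Prop :=
  exists C : seq (int * nat),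
    [/\ uniq [seq c.2 | c <- C],
        (forall c, c \in C -> odd c.2 /\ (1 < c.2)%N)
      & forall a : int, A a ->
          exists2 c, c \in C & (a = c.1 %[mod c.2%:Z])%Z].

Definition S_ (j : int) : set int :=
  [set a : int | (a = (j + 3)%R %[mod 9])%Z \/ (a = (j - 3)%R %[mod 9])%Z].

(* Main.v *)
(* After a translation the excluded classes are 4 and 7 modulo 9.  Write n_p for
   the leading p-adic digit of n, i.e. n = n_p p^(e-1) (mod p^e) with
   0 < n_p < p.  For a set S of primes, the moduli prod_(p in S) p^(e_p), taken
   over all exponents e_p > 0, together cover {n : n_p = d_p for all p in S} for
   any prescribed digits d_p, except for multiples of large powers of p.  The
   powers 3^0, 3^1, 3^2 and (3^i)_(i >= 3) as cofactors give four such families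
   for each S.  The problem becomes a finite one, the covering of a box of digit
   vectors by subboxes with prescribed supports, and a computer search solves it
   with the primes 3, 5, 7, 11, 13, 17.  What remains lies in finitely many
   classes r modulo p^K with K as large as we like; each of these is covered
   with the moduli q p^i (0 <= i < q) for a new prime q <= K.  The finitely many
   exceptions are covered with the powers of another new prime. *)
Require Import Defs.
From mathcomp Require Import all_boot all_order all_algebra.
From mathcomp Require Import boolp classical_sets cardinality.
From mathcomp Require Import zify.

Set Implicit Arguments.
Unset Strict Implicit.
Unset Printing Implicit Defensive.

Import Order.TTheory GRing.Theory Num.Theory.

Local Open Scope classical_set_scope.

(** * Coverings graded by the largest prime factor of the modulus *)

(* Restricting the largest prime factor of the moduli to the interval ]lo, hi]
   keeps the moduli of successive coverings distinct. *)
Definition covered (lo hi : nat) (A : set int) : Prop :=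
  exists (F : nat -> set int) (N : nat),
    (forall m x y, F m x -> F m y -> (x = y %[mod m%:Z])%Z) /\
    (forall a, A a ->
       exists m, [/\ (m < N)%N, odd m, (lo < max_pdiv m <= hi)%N & F m a]).

(** Each [F m] lies in one class modulo [m], so any element picked by [xget] can serve as residue.
    As [max_pdiv 1 = 1], positivity of [lo] rules out the modulus 1. *)
Lemma has_odd_covering_covered lo hi A :
  (0 < lo)%N -> covered lo hi A -> has_odd_covering A.
Proof.
move=> lo0 [F [N [Fmod FA]]].
pose ms := [seq m <- iota 0 N | odd m && (1 < m)%N].
exists [seq (xget 0%R (F m), m) | m <- ms]; split.
- by rewrite -map_comp map_id filter_uniq ?iota_uniq.
- by move=> c /mapP[m]; rewrite mem_filter => /andP[/andP[]] ? ? _ ->.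
- move=> a /FA[m [mN om /andP[lom _] Fma]].
  exists (xget 0%R (F m), m) => /=.
    apply/map_f; rewrite mem_filter om mem_iota mN andbT /=.
    by case: m om lom {mN Fma} => [|[|m]] //= _; rewrite ltnNge lo0.
  by apply: (Fmod m) => //; apply: (@xgetPex _ 0%R (F m)); exists a.
Qed.

Lemma coveredU lo mid hi A B : (lo <= mid <= hi)%N ->
  covered lo mid A -> covered mid hi B -> covered lo hi (A `|` B).
Proof.
move=> /andP[lom mhi] [F [M [Fmod FA]]] [G [N [Gmod GB]]].
exists (fun m => if (max_pdiv m <= mid)%N then F m else G m), (M + N)%N; split.
  by move=> m x y; case: ifP => _; [apply: Fmod | apply: Gmod].
move=> a [/FA | /GB] [m [mN om /andP[lem gem] h]]; exists m.
  by rewrite lem gem (leq_trans gem mhi) (leq_trans mN (leq_addr _ _)).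
rewrite [(_ <= mid)%N]leqNgt lem gem (leq_ltn_trans lom lem).
by rewrite (leq_trans mN (leq_addl _ _)).
Qed.

Lemma covered_sub lo hi A B : A `<=` B -> covered lo hi B -> covered lo hi A.
Proof. by move=> AB [F [N [Fm FB]]]; exists F, N; split=> // a /AB/FB. Qed.

Lemma covered_shift lo hi (t : int) A :
  covered lo hi A -> covered lo hi [set a | A (a + t)%R].
Proof.
move=> [F [N [Fmod FA]]].
exists (fun m => [set a | F m (a + t)%R]), N; split; last by move=> a /FA.
move=> m x y /= Fx Fy; have /eqP := Fmod _ _ _ Fx Fy.
by rewrite eqz_modDr => /eqP.
Qed.

(** * Moduli described by exponent vectors *)

Lemma coprime_prod_exp q ps (e : nat -> nat) k :
  prime q -> all prime ps -> q \notin ps ->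
  coprime (q ^ k) (\prod_(p <- ps) p ^ e p)%N.
Proof.
move=> qpr pspr qps; apply: coprimeXl; rewrite big_seq.
elim/big_ind: _ => [|m n|p pps]; first exact: coprimen1.
  by rewrite coprimeMr => -> ->.
apply: coprimeXr; rewrite prime_coprime // dvdn_prime2 ?(allP pspr _ pps) //.
by apply: contraNneq qps => ->.
Qed.

Lemma logn_prod_exp ps (e : nat -> nat) p :
  uniq ps -> all prime ps -> p \in ps ->
  logn p (\prod_(q <- ps) q ^ e q)%N = e p.
Proof.
elim: ps => //= q ps IH /andP[qps ups] /andP[qpr pspr].
have prod0 : (0 < \prod_(r <- ps) r ^ e r)%N.
  rewrite big_seq; apply: prodn_cond_gt0 => r rps.
  by rewrite expn_gt0 (prime_gt0 (allP pspr _ rps)).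
rewrite big_cons inE lognM ?expn_gt0 ?(prime_gt0 qpr) // lognX.
have [-> _|pq /= pps] := eqVneq p q.
  rewrite (pfactorK 1 qpr) muln1 logn_coprime ?addn0 //.
  exact: (coprime_prod_exp _ 1).
by rewrite IH // logn_prime // (negbTE pq) muln0.
Qed.

Lemma eqz_mod_prod_exp ps (e : nat -> nat) (x y : int) :
  uniq ps -> all prime ps ->
  {in ps, forall p, (x = y %[mod (p ^ e p)%N%:Z])%Z} ->
  (x = y %[mod (\prod_(p <- ps) p ^ e p)%N%:Z])%Z.
Proof.
move=> ups pspr h; apply/eqP; rewrite eqz_mod_dvd dvdzE absz_nat.
elim: ps ups pspr h => [|q ps IH] /=; first by rewrite big_nil dvd1n.
move=> /andP[qps ups] /andP[qpr pspr] h.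
rewrite big_cons Gauss_dvd ?coprime_prod_exp //; apply/andP; split.
  by have /eqP := h q (mem_head _ _); rewrite eqz_mod_dvd dvdzE.
by apply: IH => // p pps; apply: h; rewrite inE pps orbT.
Qed.

(* The set attached to a modulus is read off from the exponents of its prime
   factorisation, so that distinct exponent vectors automatically give distinct
   moduli. *)
Lemma covered_exponents ps K lo hi (R : (nat -> nat) -> nat -> int) (A : set int) :
  uniq ps -> all prime ps -> all odd ps -> {in ps, forall p, p <= hi}%N ->
  (forall e e', {in ps, e =1 e'} -> {in ps, R e =1 R e'}) ->
  (forall a, A a -> exists e : nat -> nat,
     [/\ {in ps, forall p, e p <= K}%N,
         exists2 p, p \in ps & (lo < p)%N && (0 < e p)%N
       & {in ps, forall p, (a = R e p %[mod (p ^ e p)%N%:Z])%Z}]) ->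
  covered lo hi A.
Proof.
move=> ups pspr psodd pshi Rext hA.
pose N := (\prod_(p <- ps) p ^ K).+1.
(* Since [m] has to factor over [ps], the residues modulo its prime powers determine the class
   modulo [m]. *)
pose F m := [set a : int | m = \prod_(p <- ps) p ^ logn p m /\
  {in ps, forall p, (a = R (logn^~ m) p %[mod (p ^ logn p m)%N%:Z])%Z}].
exists F, N; split=> [m x y [mE hx] [_ hy]|a /hA[e [eK [q qps /andP[loq eq0]] ha]]].
  rewrite mE; apply: eqz_mod_prod_exp => // p pps.
  by rewrite hx // hy.
set m := \prod_(p <- ps) p ^ e p; exists m.
have mE p : p \in ps -> logn p m = e p by apply: logn_prod_exp.
have qpr := allP pspr _ qps.
have m0 : (0 < m)%N.
  rewrite /m big_seq; apply: prodn_cond_gt0 => r rps.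
  by rewrite expn_gt0 (prime_gt0 (allP pspr _ rps)).
have qm : q \in primes m by rewrite -logn_gt0 mE.
split.
- rewrite ltnS /m big_seq [leqRHS]big_seq; apply: leq_prod => p pps.
  by rewrite leq_pexp2l ?eK ?prime_gt0 ?(allP pspr).
- rewrite /m big_seq; elim/big_ind: _ => // [x y|p pps]; first by rewrite oddM => -> ->.
  by rewrite oddX (allP psodd _ pps) orbT.
- rewrite (leq_trans loq (max_pdiv_max qm)) /=.
  have m1 : (1 < m)%N.
    by case: m m0 qm {mE} => [|[|m]] //; rewrite primes1.
  have := max_pdiv_dvd m; rewrite {2}/m Euclid_dvd_prod ?max_pdiv_prime //.
  rewrite big_has => /hasP[p pps]; rewrite Euclid_dvdX ?max_pdiv_prime // => /andP[].
  rewrite dvdn_prime2 ?max_pdiv_prime ?(allP pspr _ pps) // => /eqP -> _.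
  exact: pshi.
- split; first by rewrite {1}/m big_seq [RHS]big_seq; apply: eq_bigr => p /mE ->.
  by move=> p pps; rewrite mE // ha // (Rext _ e).
Qed.

(** * Finite sets and classes modulo high prime powers *)

Lemma covered_finite lo (A : set int) : (2 <= lo)%N ->
  finite_set A -> exists2 hi, (lo <= hi)%N & covered lo hi A.
Proof.
move=> lo2 /finite_seqP[s As]; have [q loq qpr] := prime_above lo.
exists q; first exact: ltnW.
(* The element of index i in [s] gets the modulus q^(i+1); the shift avoids q^0 = 1. *)
apply: (@covered_exponents [:: q] (size s) _ _
  (fun e p => nth 0%R s (e p).-1)) => //=.
- by rewrite qpr.
- by case: (even_prime qpr) => [q2|->] //; rewrite q2 ltnNge lo2 in loq.
- by move=> p /[!inE] /eqP ->.
- by move=> e e' ee p pq; rewrite ee.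
- rewrite As => a /= ains; exists (fun=> (index a s).+1); split.
  + by move=> p _; rewrite index_mem.
  + by exists q; rewrite ?mem_head ?loq.
  + by move=> p _; rewrite /= nth_index.
Qed.

(* A class [r] modulo [p ^ K] with [q <= K] splits into [q] classes modulo [q],
   the [i]-th of which lies in a single class modulo [q * p ^ i]. *)
Lemma covered_coset lo p q K (r : int) :
  prime p -> odd p -> prime q -> (2 <= lo)%N -> (p <= lo < q)%N -> (q <= K)%N ->
  covered lo q [set a | (a = r %[mod (p ^ K)%N%:Z])%Z].
Proof.
move=> ppr podd qpr lo2 /andP[plo loq] qK.
have pq : (p < q)%N by apply: leq_ltn_trans loq.
have qodd : odd q.
  by case: (even_prime qpr) => [q2|->] //; rewrite q2 ltnNge lo2 in loq.
(* The residue modulo [q] is the exponent of [p] itself, so q p^i picks the class i modulo [q]. *)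
apply: (@covered_exponents [:: p; q] K _ _
  (fun e x => if x == q then Posz (e p) else r)) => /=.
- by rewrite inE andbT ltn_eqF.
- by rewrite ppr qpr.
- by rewrite podd qodd.
- by move=> x /[!inE] /orP[] /eqP -> //; apply: ltnW.
- by move=> e e' ee x _; rewrite ee ?mem_head.
move=> a ha; pose i := `|(a %% q%:Z)%Z|%N.
have q0 : (q%:Z != 0)%R by rewrite eqz_nat -lt0n prime_gt0.
have iE : Posz i = (a %% q%:Z)%Z by rewrite gez0_abs ?modz_ge0.
have iq : (i < q)%N by rewrite -ltz_nat iE ltz_pmod // ltz_nat prime_gt0.
exists (fun x => if x == q then 1%N else i); split.
- move=> x _; case: ifP => _; first exact: leq_trans (prime_gt0 qpr) qK.
  exact: leq_trans (ltnW iq) qK.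
- by exists q; rewrite ?inE ?eqxx ?orbT ?loq.
- move=> x /[!inE] /orP[] /eqP ->; last by rewrite eqxx (ltn_eqF pq) iE expn1 modz_mod.
  rewrite (ltn_eqF pq); move/eqP: ha; rewrite eqz_mod_dvd => ha; apply/eqP.
  rewrite eqz_mod_dvd; apply: dvdz_trans ha.
  by rewrite dvdzE /= dvdn_exp2l // (leq_trans (ltnW iq) qK).
Qed.

(** The new primes depend only on the length of the list and on [lo], so [hi] is fixed before [K].
    This avoids a circle, as [covered_coset] needs q <= K. *)
Lemma covered_cosets (L : seq (nat * int)) lo : (2 <= lo)%N ->
  {in L, forall c, [&& prime c.1, odd c.1 & c.1 <= lo]%N} ->
  exists2 hi, (lo <= hi)%N & forall K, (hi <= K)%N ->
    covered lo hi
      [set a | exists2 c, c \in L & (a = c.2 %[mod (c.1 ^ K)%N%:Z])%Z].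
Proof.
elim: L lo => [|[p r] L IH] lo lo2 hL.
  exists lo => // K _; apply: (@covered_sub _ _ _ set0) => [a [] //|].
  by exists (fun=> set0), 0%N.
have [q loq qpr] := prime_above lo.
have /and3P[/= ppr podd plo] := hL _ (mem_head _ _).
have [] := IH q (leq_trans lo2 (ltnW loq)).
  move=> c cL; have /and3P[-> -> /= clo] : [&& prime c.1, odd c.1 & c.1 <= lo]%N.
    by apply: hL; rewrite inE cL orbT.
  exact: leq_trans clo (ltnW loq).
move=> hi qhi hhi; exists hi; first exact: leq_trans (ltnW loq) qhi.
move=> K hiK; apply: covered_sub (coveredU _
  (covered_coset r ppr podd qpr lo2 _ (leq_trans qhi hiK)) (hhi K hiK)).
- move=> a [c /[!inE] /orP[/eqP -> |cL] ha]; first by left.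
  by right; exists c.
- by rewrite (ltnW loq).
- by rewrite plo.
Qed.

(** * Leading digits and the finite covering table *)

Lemma leading_digit p K (x : int) : (1 < p)%N -> ~~ ((p ^ K)%N%:Z %| x)%Z ->
  exists e d, [/\ (0 < e <= K)%N, (0 < d < p)%N
    & (x = (d * p ^ e.-1)%N%:Z %[mod (p ^ e)%N%:Z])%Z].
Proof.
move=> p1; elim: K => [|K IH]; first by rewrite expn0 dvd1z.
have [/dvdzP[y xE]|/IH] := boolP ((p ^ K)%N%:Z %| x)%Z; last first.
  move=> [e [d [/andP[e0 eK] dp xE]]] _; exists e, d; split=> //.
  by rewrite e0 (leq_trans eK).
have p0 : (p%:Z != 0)%R by rewrite eqz_nat -lt0n ltnW.
pose d := `|(y %% p%:Z)%Z|%N.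
have dE : Posz d = (y %% p%:Z)%Z by rewrite gez0_abs ?modz_ge0.
have dp : (d < p)%N by rewrite -ltz_nat dE ltz_pmod // ltz_nat ltnW.
have xd : (x = (d * p ^ K)%N%:Z %[mod (p ^ K.+1)%N%:Z])%Z.
  apply/eqP; rewrite eqz_mod_dvd xE PoszM -mulrBl expnS PoszM.
  by apply: dvdz_mul => //; rewrite -eqz_mod_dvd dE modz_mod.
move=> npx; exists K.+1, d; rewrite dp ltnSn; split=> //; rewrite andbT lt0n.
apply: contraNneq npx => d0; rewrite d0 mul0n mod0z in xd.
exact/dvdz_mod0P.
Qed.

(* The entry (k, b, d, [:: d5; d7; d11; d13; d17]) stands for the congruences with
   residue b + d 3^(i-1) modulo 3^i, where i = k if k < 3 and i >= 3 is arbitrary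
   if k = 3, and with leading p-adic digit d_p for the primes p with d_p <> 0;
   the primes with d_p = 0 do not divide the modulus.  The first two entries are
   2 (mod 3) and 1 (mod 9); the rest concerns the multiples of 3, split according
   to their class b = 0, 3, 6 modulo 9 and the leading 3-adic digit of n - b.
   The last 16 entries use 17 to cover the one digit vector that is left over by
   the primes up to 13. *)
Definition table : seq (nat * nat * nat * seq nat) :=
  [:: (1, 2, 0, [:: 0; 0; 0; 0; 0]); (2, 1, 0, [:: 0; 0; 0; 0; 0]);
     (3, 0, 1, [:: 0; 0; 0; 0; 0]); (0, 0, 0, [:: 1; 0; 0; 0; 0]);
     (1, 0, 0, [:: 2; 0; 0; 0; 0]); (2, 6, 0, [:: 4; 0; 0; 0; 0]);
     (3, 0, 2, [:: 4; 0; 0; 0; 0]); (0, 0, 0, [:: 0; 5; 0; 0; 0]);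
     (1, 0, 0, [:: 0; 4; 0; 0; 0]); (2, 3, 0, [:: 0; 1; 0; 0; 0]);
     (3, 0, 2, [:: 0; 1; 0; 0; 0]); (0, 0, 0, [:: 3; 3; 0; 0; 0]);
     (1, 0, 0, [:: 3; 2; 0; 0; 0]); (2, 6, 0, [:: 3; 1; 0; 0; 0]);
     (3, 3, 1, [:: 4; 3; 0; 0; 0]); (0, 0, 0, [:: 0; 0; 1; 0; 0]);
     (1, 0, 0, [:: 0; 0; 3; 0; 0]); (2, 3, 0, [:: 0; 0; 5; 0; 0]);
     (3, 3, 1, [:: 0; 0; 9; 0; 0]); (0, 0, 0, [:: 4; 0; 8; 0; 0]);
     (1, 0, 0, [:: 4; 0; 2; 0; 0]); (2, 3, 0, [:: 4; 0; 10; 0; 0]);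
     (3, 3, 2, [:: 4; 0; 9; 0; 0]); (0, 0, 0, [:: 0; 6; 7; 0; 0]);
     (1, 0, 0, [:: 0; 6; 4; 0; 0]); (2, 3, 0, [:: 0; 2; 4; 0; 0]);
     (3, 3, 2, [:: 0; 3; 4; 0; 0]); (0, 0, 0, [:: 3; 6; 8; 0; 0]);
     (1, 0, 0, [:: 3; 6; 10; 0; 0]); (2, 3, 0, [:: 4; 2; 7; 0; 0]);
     (3, 3, 2, [:: 4; 3; 7; 0; 0]); (0, 0, 0, [:: 0; 0; 0; 6; 0]);
     (1, 0, 0, [:: 0; 0; 0; 4; 0]); (2, 3, 0, [:: 0; 0; 0; 7; 0]);
     (3, 3, 2, [:: 0; 0; 0; 5; 0]); (0, 0, 0, [:: 3; 0; 0; 12; 0]);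
     (1, 0, 0, [:: 3; 0; 0; 9; 0]); (2, 6, 0, [:: 3; 0; 0; 7; 0]);
     (3, 0, 2, [:: 3; 0; 0; 1; 0]); (0, 0, 0, [:: 0; 6; 0; 3; 0]);
     (1, 0, 0, [:: 0; 6; 0; 2; 0]); (2, 6, 0, [:: 0; 6; 0; 1; 0]);
     (3, 0, 2, [:: 0; 6; 0; 5; 0]); (0, 0, 0, [:: 0; 0; 6; 1; 0]);
     (1, 0, 0, [:: 0; 0; 6; 11; 0]); (2, 3, 0, [:: 0; 0; 6; 10; 0]);
     (3, 3, 1, [:: 0; 0; 6; 5; 0]); (0, 0, 0, [:: 3; 6; 0; 10; 0]);
     (1, 0, 0, [:: 3; 6; 0; 8; 0]); (2, 6, 0, [:: 3; 6; 0; 5; 0]);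
     (3, 0, 2, [:: 3; 6; 0; 7; 0]); (0, 0, 0, [:: 4; 0; 6; 9; 0]);
     (1, 0, 0, [:: 4; 0; 6; 8; 0]); (2, 3, 0, [:: 4; 0; 6; 12; 0]);
     (3, 3, 2, [:: 4; 0; 6; 3; 0]); (0, 0, 0, [:: 0; 6; 9; 11; 0]);
     (1, 0, 0, [:: 0; 6; 9; 1; 0]); (2, 3, 0, [:: 0; 6; 2; 1; 0]);
     (3, 3, 1, [:: 0; 2; 6; 3; 0]); (0, 0, 0, [:: 3; 6; 2; 11; 0]);
     (1, 0, 0, [:: 3; 6; 5; 11; 0]); (2, 3, 0, [:: 4; 2; 6; 2; 0]);
     (3, 3, 2, [:: 4; 3; 6; 2; 0]); (0, 0, 0, [:: 0; 0; 0; 0; 1]);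
     (1, 0, 0, [:: 0; 0; 0; 0; 2]); (0, 0, 0, [:: 3; 0; 0; 0; 3]);
     (1, 0, 0, [:: 3; 0; 0; 0; 4]); (0, 0, 0, [:: 0; 6; 0; 0; 5]);
     (1, 0, 0, [:: 0; 6; 0; 0; 6]); (0, 0, 0, [:: 3; 6; 0; 0; 7]);
     (1, 0, 0, [:: 3; 6; 0; 0; 8]); (0, 0, 0, [:: 0; 0; 2; 0; 9]);
     (1, 0, 0, [:: 0; 0; 2; 0; 10]); (0, 0, 0, [:: 3; 0; 2; 0; 11]);
     (1, 0, 0, [:: 3; 0; 2; 0; 12]); (0, 0, 0, [:: 0; 6; 2; 0; 13]);
     (1, 0, 0, [:: 0; 6; 2; 0; 14]); (0, 0, 0, [:: 3; 6; 2; 0; 15]);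
     (1, 0, 0, [:: 3; 6; 2; 0; 16])].

Definition odd_primes := [:: 5; 7; 11; 13; 17].

(** A search tree over the box of nonzero digit vectors, a 0 in a row being a wildcard. Pruning [T]
    after each digit keeps the computation small. *)
Fixpoint exhausts (qs : seq nat) (T : seq (seq nat)) : bool :=
  if qs is q :: qs' then
    all (fun d => exhausts qs' [seq behead s | s <- T & head 0 s \in [:: 0; d]])
      (iota 1 q.-1)
  else T != [::].

Lemma exhaustsP qs T (D : nat -> nat) :
  exhausts qs T -> {in qs, forall q, 0 < D q < q}%N ->
  exists2 s, s \in T &
    forall i, (i < size qs)%N -> nth 0 s i \in [:: 0; D (nth 0 qs i)].
Proof.
elim: qs T => [|q qs IH] T /=.
  by case: T => // s T _ _; exists s; rewrite ?mem_head.
move=> /allP ex Dq; have /andP[D0 Dltq] := Dq q (mem_head _ _).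
have /ex/IH[|s] : D q \in iota 1 q.-1.
- by rewrite mem_iota D0 add1n prednK // (leq_trans _ Dltq).
- by move=> p pqs; apply: Dq; rewrite inE pqs orbT.
move=> /mapP[s' + ->]; rewrite mem_filter => /andP[hd s'T] sD.
by exists s' => // -[|i] iqs; [rewrite /= nth0 | rewrite -nth_behead sD].
Qed.

(** Selects the entries whose 3-part holds for a number n in class [b] modulo 9 such that n - b has
    leading 3-adic digit [d]. *)
Definition fits (b d : nat) (t : nat * nat * nat * seq nat) : bool :=
  let: (k, b', d', _) := t in
  if k < 3 then b == b' %[mod 3 ^ k] else (b == b') && (d == d').

Lemma table_exhausts b d : b \in [:: 0; 3; 6] -> d \in [:: 1; 2] ->
  exhausts odd_primes [seq t.2 | t <- table & fits b d t].
Proof.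
have : all (fun b => all (fun d =>
    exhausts odd_primes [seq t.2 | t <- table & fits b d t]) [:: 1; 2])
  [:: 0; 3; 6] by vm_compute.
by move=> /allP h /h /allP; apply.
Qed.

(* The signature determines which moduli an entry uses, so its injectivity on the
   table means that no modulus is used by two entries. *)
Definition signature (t : nat * nat * nat * seq nat) :=
  (t.1.1.1, [seq d != 0 | d <- t.2]).

(** The third clause reduces b + d 3^(i-1) to b for the fixed cofactors 1, 3, 9; the last one keeps
    the modulus from being 1. *)
Lemma table_wf t : t \in table ->
  [/\ size t.2 = 5, (t.1.1.1 <= 3)%N, (t.1.1.1 < 3)%N -> t.1.2 = 0
    & (0 < t.1.1.1)%N || has (ltn 0) t.2].
Proof.
have : all (fun t => [&& size t.2 == 5, (t.1.1.1 <= 3)%N,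
   (t.1.1.1 < 3)%N ==> (t.1.2 == 0) & (0 < t.1.1.1)%N || has (ltn 0) t.2]) table.
  by vm_compute.
by move=> /allP h /h /and4P[/eqP ? ? /implyP h0 ?]; split=> // /h0/eqP.
Qed.

Lemma uniq_signature_table : uniq [seq signature t | t <- table].
Proof. by vm_compute. Qed.

(** * Residues for exponent vectors and the main covering *)

Definition exponent_signature (e : nat -> nat) :=
  (minn 3 (e 3), [seq e p != 0 | p <- odd_primes]).

(** A vector matching no entry gets the default, hence residue 0, which is harmless. *)
Definition lookup (e : nat -> nat) :=
  nth (0, 0, 0, [::]) table
    (index (exponent_signature e) [seq signature t | t <- table]).

Definition residue (e : nat -> nat) (p : nat) : int :=
  let: (_, b, d, ds) := lookup e in
  Posz (if p == 3 then b + d * 3 ^ (e 3).-1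
        else nth 0 ds (index p odd_primes) * p ^ (e p).-1).

Lemma lookup_table e t :
  t \in table -> signature t = exponent_signature e -> lookup e = t.
Proof.
move=> tT te; rewrite /lookup -te -(nth_index (0, 0, 0, [::]) tT).
rewrite -[signature _](nth_map _ (signature (0, 0, 0, [::]))) ?index_mem //.
by rewrite index_uniq ?size_map ?index_mem // uniq_signature_table.
Qed.

Lemma residue_ext e e' : {in 3 :: odd_primes, e =1 e'} ->
  {in 3 :: odd_primes, residue e =1 residue e'}.
Proof.
move=> ee p pps; have e3 : e 3 = e' 3 by apply: ee.
have ep : e p = e' p by apply: ee.
have se : exponent_signature e = exponent_signature e'.
  rewrite /exponent_signature e3; congr pair.
  by apply/eq_in_map => q qp; rewrite ee // inE qp orbT.
by rewrite /residue /lookup se ep e3.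
Qed.

(** The centres near which a leading digit may not show up below the [K]-th power. *)
Definition thin_cosets : seq (nat * int) :=
  [seq (3, Posz b) | b <- [:: 0; 3; 6]] ++ [seq (p, Posz 0) | p <- odd_primes].

Lemma covered_main K : (3 <= K)%N -> covered 2 17
  [set a | [/\ (a %% 9)%Z <> 4, (a %% 9)%Z <> 7 &
     {in thin_cosets, forall c, (a <> c.2 %[mod (c.1 ^ K)%N%:Z])%Z}]].
Proof.
move=> K3; apply: (@covered_exponents (3 :: odd_primes) K _ _ residue) => //.
- by apply/allP.
- exact: residue_ext.
move=> a [na4 na7 nthin].
have pn3 p : p \in odd_primes -> (p == 3) = false.
  by move=> pps; apply/negbTE; move: p pps; apply/allP.
(* Equality of signatures makes [lookup e] return [t], so [residue e] is given by [t]. *)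
suff [e [t [tT te eK ha3 hap]]] : exists e t, [/\ t \in table,
    signature t = exponent_signature e,
    {in 3 :: odd_primes, forall p, e p <= K}%N,
    (a = (t.1.1.2 + t.1.2 * 3 ^ (e 3).-1)%N%:Z %[mod (3 ^ e 3)%N%:Z])%Z
  & {in odd_primes, forall p,
      (a = (nth 0 t.2 (index p odd_primes) * p ^ (e p).-1)%N%:Z
         %[mod (p ^ e p)%N%:Z])%Z}].
  exists e; split=> // [|p].
    have [_ _ _ /orP[k0|/hasP[d dt d0]]] := table_wf tT.
      exists 3; rewrite ?mem_head //=; move: k0.
      rewrite (congr1 fst te : t.1.1.1 = _).
      by rewrite leq_min => /andP[].
    have : true \in [seq e p != 0 | p <- odd_primes].
      have <- : [seq d != 0 | d <- t.2] = [seq e p != 0 | p <- odd_primes].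
        exact: (congr1 snd te).
      by apply/mapP; exists d; rewrite // -lt0n; apply: esym d0.
    move=> /mapP[p pps ep]; exists p; first by rewrite inE pps orbT.
    by rewrite lt0n -ep andbT; move: p pps {ep}; apply/allP.
  rewrite /residue (lookup_table tT te).
  case: t tT te ha3 hap => [[[k b] d] ds] /= _ _ ha3 hap.
  by rewrite inE; case: eqP => [->|_ /= /hap].
have [a2|a2] := eqVneq (a %% 3)%Z 2.
  exists (fun p => nat_of_bool (p == 3)), (1, 2, 0, [:: 0; 0; 0; 0; 0]); split=> //=.
  - by move=> p _; case: eqP => // _; apply: leq_trans K3.
  - by move=> p pps; rewrite pn3 // !modz1.
have [a1|a1] := eqVneq (a %% 9)%Z 1.
  exists (fun p => if p == 3 then 2 else 0), (2, 1, 0, [:: 0; 0; 0; 0; 0]); split=> //=.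
  - by move=> p _; case: eqP => // _; apply: leq_trans K3.
  - by move=> p pps; rewrite pn3 // !modz1.
have [b b036 ab] : exists2 b, b \in [:: 0; 3; 6] & (a %% 9)%Z = Posz b.
  have : (a %% 9)%Z \in [:: 0; 3; 6]%Z by rewrite !inE; lia.
  by rewrite !inE => /or3P[] /eqP ->; [exists 0 | exists 3 | exists 6].
have [|i [d [/andP[i0 iK] /andP[d0 d3] ad]]] :=
  @leading_digit 3 K (a - Posz b)%R isT.
  rewrite -eqz_mod_dvd; apply/eqP; apply: (nthin (3, Posz b)).
  by rewrite mem_cat; apply/orP; left; apply: map_f.
(* 9 divides a - b, so its leading digit sits at 3^2 or higher. *)
have i3 : (3 <= i)%N.
  case: i i0 iK ad => [|[|[|i]]] // _ _ /= ad; exfalso; lia.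
have /choice[f fP] : forall p, exists ed : nat * nat, p \in odd_primes ->
    [/\ (0 < ed.1 <= K)%N, (0 < ed.2 < p)%N
      & (a = (ed.2 * p ^ ed.1.-1)%N%:Z %[mod (p ^ ed.1)%N%:Z])%Z].
  move=> p; have [pps|] := boolP (p \in odd_primes); last by exists (0, 0).
  have [||e [d' h]] := @leading_digit p K a.
  - by move: p pps; apply/allP.
  - apply/negP => /dvdz_mod0P; rewrite -[RHS](mod0z (p ^ K)%N%:Z).
    apply: (nthin (p, Posz 0)).
    by rewrite mem_cat; apply/orP; right; apply: map_f.
  by exists (e, d').
have d12 : d \in [:: 1; 2] by rewrite !inE; lia.
have [|s /mapP[t + ->] sD] :=
  exhaustsP (D := fun p => (f p).2) (table_exhausts b036 d12).
  by move=> p /fP[].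
rewrite mem_filter => /andP[tfits tT]; have [sz k3 d'0 _] := table_wf tT.
(* At the primes in the support of [t], the exponent is the one at which [a] shows its leading
   digit. *)
pose e p := if p == 3 then (if (t.1.1.1 < 3)%N then t.1.1.1 else i)
  else if nth 0 t.2 (index p odd_primes) == 0 then 0 else (f p).1.
exists e, t; split=> //.
- rewrite /signature /exponent_signature; congr pair.
    rewrite /e eqxx; case: ltnP => tk; first by rewrite (minn_idPr (ltnW tk)).
    by rewrite (minn_idPl i3); apply/eqP; rewrite eqn_leq k3.
  apply: (@eq_from_nth _ false); rewrite ?size_map ?sz // => j j5.
  rewrite (nth_map 0 false (fun d1 => d1 != 0)) ?sz //; rewrite (nth_map 0) //.
  have jps : nth 0 odd_primes j \in odd_primes by apply: mem_nth.
  rewrite /e pn3 // index_uniq //.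
  case: eqVneq => // _; have [/andP[f0 _] _ _] := fP _ jps.
  by rewrite -lt0n f0.
- move=> p; rewrite inE /e; case: eqVneq => [_ _|_ /= /fP[/andP[_ fK] _ _]].
    by case: ltnP => // tk; apply: leq_trans K3.
  by case: ifP.
- rewrite /e eqxx; case: t tfits d'0 k3 {sD tT sz e} => [[[k b'] d'] ds] /=.
  case: ltnP => [k3 /eqP bb' /(_ isT) -> _|_ /andP[/eqP <- /eqP <-] _ _].
    rewrite mul0n addn0; move: bb' ab {ad fP}.
    case: k k3 => [|[|[|k]]] //= _; rewrite ?expn0 ?expn1 /=; lia.
  move/eqP: ad; rewrite eqz_mod_dvd => ad; apply/eqP; rewrite eqz_mod_dvd.
  by rewrite PoszD opprD addrA.
- move=> p pps; have /sD : (index p odd_primes < size odd_primes)%N by rewrite index_mem.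
  rewrite nth_index // /e pn3 // !inE.
  case: eqVneq => [_ _|_ /= /eqP ->]; first by rewrite expn0 !modz1.
  by have [] := fP _ pps.
Qed.

(** * Assembling the three coverings *)

Theorem theorem3p1 (j : int) (hj0 : (0 <= j)%R) (hj8 : (j <= 8)%R)
    (T : set int) (hT : finite_set (T `&` S_ j)) :
  has_odd_covering T.
Proof.
have [|hi hi17 cthin] := @covered_cosets thin_cosets 17 isT.
  by move=> c cin; move: c cin; apply/allP.
have [hi' hihi' cfin] := covered_finite (leq_trans (isT : 2 <= 17)%N hi17) hT.
have K3 : (3 <= hi)%N by apply: leq_trans hi17.
have h17 : (2 <= 17 <= hi)%N by rewrite hi17.
(* Here [K] is [hi]. The largest prime factors lie in ]2, 17], ]17, hi] and, for the finite part,
   ]hi, hi']. *)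
have cov := coveredU h17 (covered_main K3) (cthin hi (leqnn _)).
have hU : (2 <= hi <= hi')%N by rewrite (ltnW K3).
apply: (@has_odd_covering_covered 2 hi') => //.
(* Adding 1 - j moves the classes j + 3 and j - 3 modulo 9 to 4 and 7. *)
apply: covered_sub (coveredU hU (covered_shift (1 - j)%R cov) cfin) => a Ta.
have [Sa|nSa] := EM (S_ j a); first by right.
left; set x := (a + (1 - j))%R => /=.
have [thin|nthin] := EM (exists2 c, c \in thin_cosets &
    (x = c.2 %[mod (c.1 ^ hi)%N%:Z])%Z); first by right.
left; split.
- move=> x4; apply: nSa; left; move: x4; rewrite /x; lia.
- move=> x7; apply: nSa; right; move: x7; rewrite /x; lia.
- by move=> c cin xc; apply: nthin; exists c.
Qed.
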